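(* Let $\alpha \in (0,\pi)$ with $\alpha \neq \frac{\pi}{2}$, and put $k := \cot\alpha$. In the coordinates $(\Theta,\Phi)$ on the shape sphere of triangles, associated with the choice of base $BC$ and apex $A$, the curve of constant angle $\alpha$ (the set of shapes of non-collinear labelled triangles $ABC$ whose interior angle at $A$ equals $\alpha$) is given by $$\Phi = \arcsin\left(\frac{1 - 2\cos\Theta}{\sqrt{3}\,k\,\sin\Theta}\right),$$ where $\arcsin$ denotes the inverse sine relation with values $\Phi\in(0,\pi)$. That is, for a non-collinear triangle with coordinates $(\Theta,\Phi)\in(0,\pi)\times(0,\pi)$, the interior angle at $A$ equals $\alpha$ if and only if $$\sin\Phi = \frac{1-2\cos\Theta}{\sqrt{3}\,k\,\sin\Theta}.$$
   Context: Let $q_A, q_B, q_C \in \mathbb{R}^2$ be the vertices of a labelled triangle. The relative Jacobi vectors for the base $BC$ are $R_1 = q_C - q_B$ (the base side) and $R_2 = q_A - \frac{q_B+q_C}{2}$ (the corresponding median). Their associated cluster masses are $\mu_1 = \frac12$ and $\mu_2 = \frac23$. The mass-weighted relative Jacobi vectors are $\rho_i = \sqrt{\mu_i}\,R_i$ for $i=1,2$. The ratio of Jacobi magnitudes is $\mathcal{R} := |\rho_2|/|\rho_1| = \frac{2}{\sqrt3}\,\frac{|R_2|}{|R_1|}$. The relative Jacobi angle is $\Phi := \arccos\left(\frac{\rho_1\cdot\rho_2}{|\rho_1||\rho_2|}\right)$, the angle between the base $BC$ and the median from $A$. For a non-collinear triangle, $\Phi\in(0,\pi)$. The azimuthal coordinate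 $\Theta\in(0,\pi)$ is defined by $\mathcal{R} = \tan\frac{\Theta}{2}$. The pair $(\Theta,\Phi)$ are spherical polar coordinates on Kendall's shape sphere of triangles (the space of triangles modulo translations, rotations and dilations), with metric $d\Theta^2 + \sin^2\Theta\, d\Phi^2$. The angle $\alpha$ is the interior angle of the triangle at the vertex $A$, i.e. opposite the base $BC$. Collinear configurations, including those with coincident vertices (for which angles may be undefined), are excluded from the curve. *)

(* Defs.v *)
From mathcomp Require Import all_boot all_order all_algebra.
From mathcomp Require Import all_classical all_reals all_analysis.

Set Implicit Arguments.
Unset Strict Implicit.
Unset Printing Implicit Defensive.

Import Order.TTheory GRing.Theory Num.Theory.

Local Open Scope classical_set_scope.
Local Open Scope ring_scope.

Section Plane.
Context {R : realType}.
Implicit Types u v : 'rV[R]_2.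

Definition dot u v : R := \sum_(i < 2) u 0 i * v 0 i.

(* The library norm on 'rV[R]_2 is the sup norm, hence this definition. *)
Definition enorm u : R := Num.sqrt (dot u u).

(* Meaningful only when u and v are both nonzero. *)
Definition vec_angle u v : R := acos (dot u v / (enorm u * enorm v)).

Definition cot (x : R) : R := cos x / sin x.

(* Graph of the inverse sine relation with values in ]0, pi[ (multivalued,
   unlike asin, which takes its values in [-pi/2, pi/2]). *)
Definition arcsin_rel (x y : R) : Prop := 0 < y < pi /\ sin y = x.

End Plane.

Record triangle (R : realType) := Triangle {
  qA : 'rV[R]_2 ;
  qB : 'rV[R]_2 ;
  qC : 'rV[R]_2 }.

Section Triangles.
Context {R : realType}.
Implicit Types (T : triangle R) (s : set (triangle R)).

(* Triangles with coincident vertices are collinear in this sense. *)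
Definition collinear T : Prop :=
  exists p d : 'rV[R]_2, d != 0 /\
    exists a b c : R,
      [/\ qA T = p + a *: d, qB T = p + b *: d & qC T = p + c *: d].

Definition interior_angle_A T : R := vec_angle (qB T - qA T) (qC T - qA T).

Definition jacobi1 T : 'rV[R]_2 := qC T - qB T.
Definition jacobi2 T : 'rV[R]_2 := qA T - 2^-1 *: (qB T + qC T).

Definition mu1 : R := 1 / 2.
Definition mu2 : R := 2 / 3.

Definition rho1 T : 'rV[R]_2 := Num.sqrt mu1 *: jacobi1 T.
Definition rho2 T : 'rV[R]_2 := Num.sqrt mu2 *: jacobi2 T.

Definition jacobi_ratio T : R := enorm (rho2 T) / enorm (rho1 T).
Definition jacobi_angle T : R := vec_angle (rho1 T) (rho2 T).

Definition has_coordinates T (Theta Phi : R) : Prop :=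
  [/\ 0 < Theta < pi, jacobi_ratio T = tan (Theta / 2)
    & Phi = jacobi_angle T].

(* Orientation-preserving similarity of labelled triangles; vectors are rows,
   so a rotation acts by right multiplication. *)
Definition similar T1 T2 : Prop :=
  exists (lam : R) (M : 'M[R]_2) (b : 'rV[R]_2),
    [/\ 0 < lam, M *m M^T = 1%:M, \det M = 1
      & let f q := lam *: (q *m M) + b in
        [/\ qA T2 = f (qA T1), qB T2 = f (qB T1) & qC T2 = f (qC T1)]].

(* A shape is represented by its similarity class. *)
Definition shape T : set (triangle R) := [set T' | similar T T'].

Definition constant_angle_curve (alpha : R) : set (set (triangle R)) :=
  [set shape T | T in [set T | ~ collinear T /\ interior_angle_A T = alpha]].

(* (Theta, Phi) does not see orientation: mirror-image shapes have the same
   coordinates. *)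
Definition in_coordinates (K : set (set (triangle R))) : set (R * R) :=
  [set p | exists s T, [/\ K s, s T & has_coordinates T p.1 p.2]].

End Triangles.

(* Main.v *)
(** With [u = AB] and [v = AC], the Jacobi vectors are [R1 = v - u] and
    [R2 = - (u + v) / 2], so that [dot u v = |R2|^2 - |R1|^2 / 4] and
    [cross u v = cross R1 R2 = +- |R1| |R2| sin Phi].  Hence
    [cot A = (|R2|^2 - |R1|^2 / 4) / (|R1| |R2| sin Phi)], and substituting
    [|R2| / |R1| = sqrt 3 / 2 * tan (Theta / 2)] gives
    [cot A = (1 - 2 cos Theta) / (sqrt 3 sin Theta sin Phi)].
    Since [cot] is injective on [(0, pi)], the equivalence follows. *)

Require Import Defs.
From mathcomp Require Import all_boot all_order all_algebra.
From mathcomp Require Import all_classical all_reals all_analysis.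
From mathcomp Require Import ring lra.

Set Implicit Arguments.
Unset Strict Implicit.
Unset Printing Implicit Defensive.

Import Order.TTheory GRing.Theory Num.Theory.

Local Open Scope classical_set_scope.
Local Open Scope ring_scope.

(** * Dot and cross products in the plane *)

Definition cross {R : realType} (u v : 'rV[R]_2) : R :=
  u 0 0 * v 0 1 - u 0 1 * v 0 0.

Lemma sum2E (R : realType) (F : 'I_2 -> R) : \sum_(i < 2) F i = F 0 + F 1.
Proof. by rewrite !big_ord_recl big_ord0 addr0; congr (_ + F _); apply: val_inj. Qed.

Lemma row2P (R : realType) (u v : 'rV[R]_2) :
  u 0 0 = v 0 0 -> u 0 1 = v 0 1 -> u = v.
Proof.
move=> e0 e1; apply/rowP => -[[|[|//]] lti].
  by rewrite (_ : Ordinal _ = 0) //; apply: val_inj.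
by rewrite (_ : Ordinal _ = 1) //; apply: val_inj.
Qed.

Lemma dotE (R : realType) (u v : 'rV[R]_2) :
  dot u v = u 0 0 * v 0 0 + u 0 1 * v 0 1.
Proof. exact: sum2E. Qed.

(** Lagrange's identity: the Pythagorean identity for the angle between [u] and [v], in polynomial
    form. *)
Lemma dot_cross (R : realType) (u v : 'rV[R]_2) :
  dot u v ^+ 2 + cross u v ^+ 2 = dot u u * dot v v.
Proof. rewrite !dotE /cross; ring. Qed.

Lemma dotvv_ge0 (R : realType) (u : 'rV[R]_2) : 0 <= dot u u.
Proof. by rewrite dotE -!expr2 addr_ge0 ?sqr_ge0. Qed.

Lemma enorm_sqr (R : realType) (u : 'rV[R]_2) : enorm u ^+ 2 = dot u u.
Proof. by rewrite sqr_sqrtr ?dotvv_ge0. Qed.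

Lemma cross_enorm_gt0 (R : realType) (u v : 'rV[R]_2) :
  cross u v != 0 -> 0 < enorm u /\ 0 < enorm v.
Proof.
move=> uv; have : 0 < dot u u * dot v v.
  by rewrite -dot_cross ltr_wpDl ?sqr_ge0 // exprn_even_gt0.
by rewrite -!enorm_sqr -exprMn exprn_even_gt0 //= mulf_eq0 negb_or !lt_def
  !sqrtr_ge0 !andbT => /andP.
Qed.

(** * Scaling, angles and cotangents *)

Lemma enormZ (R : realType) (a : R) (u : 'rV[R]_2) :
  0 <= a -> enorm (a *: u) = a * enorm u.
Proof.
move=> a0; rewrite /enorm (_ : dot (a *: u) _ = a ^+ 2 * dot u u); last first.
  by rewrite !dotE !mxE; ring.
by rewrite sqrtrM ?sqr_ge0 // sqrtr_sqr ger0_norm.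
Qed.

Lemma dotZ (R : realType) (a b : R) (u v : 'rV[R]_2) :
  dot (a *: u) (b *: v) = a * b * dot u v.
Proof. by rewrite !dotE !mxE; ring. Qed.

Lemma crossZ (R : realType) (a b : R) (u v : 'rV[R]_2) :
  cross (a *: u) (b *: v) = a * b * cross u v.
Proof. by rewrite /cross !mxE; ring. Qed.

Lemma vec_angleZ (R : realType) (a b : R) (u v : 'rV[R]_2) :
  0 < a -> 0 < b -> vec_angle (a *: u) (b *: v) = vec_angle u v.
Proof.
move=> a0 b0; rewrite /vec_angle dotZ !enormZ ?ltW // mulrACA.
by rewrite -mulf_div divff ?mul1r // mulf_neq0 ?gt_eqF.
Qed.

(** By Lagrange's identity a nonzero cross product keeps the normalized dot product strictly between
    -1 and 1, so the angle avoids 0 and [pi]. The sine of an [acos] is a nonnegative square root,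
    hence the absolute value. *)
Lemma vec_angle_trig (R : realType) (u v : 'rV[R]_2) : cross u v != 0 ->
  [/\ 0 < vec_angle u v < pi,
      cos (vec_angle u v) = dot u v / (enorm u * enorm v) &
      sin (vec_angle u v) = `|cross u v| / (enorm u * enorm v)].
Proof.
move=> uv; have [nu nv] := cross_enorm_gt0 uv.
have nuv : 0 < enorm u * enorm v by rewrite mulr_gt0.
have E : 1 - (dot u v / (enorm u * enorm v)) ^+ 2 =
    (`|cross u v| / (enorm u * enorm v)) ^+ 2.
  have := dot_cross u v; rewrite -!enorm_sqr => h.
  rewrite !expr_div_n real_normK ?num_real // exprMn.
  have -> : cross u v ^+ 2 = enorm u ^+ 2 * enorm v ^+ 2 - dot u v ^+ 2.
    by rewrite -h addrC addKr.
  by field; rewrite !gt_eqF.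
have lt1 : -1 < dot u v / (enorm u * enorm v) < 1.
  rewrite -ltr_norml -(@ltr_pXn2r _ 2) ?nnegrE ?ler01 // expr1n.
  rewrite real_normK ?num_real // -subr_gt0 E exprn_gt0 // divr_gt0 //.
  by rewrite normr_gt0.
have /andP[l1 l2] := lt1.
have le1 : -1 <= dot u v / (enorm u * enorm v) <= 1 by rewrite !ltW.
split; first by rewrite acos_gt0 ?acos_ltpi ?l1 ?l2 ?ltW.
  by rewrite acosK // in_itv.
by rewrite sin_acos // E sqrtr_sqr ger0_norm // divr_ge0 // ltW.
Qed.

Lemma cot_vec_angle (R : realType) (u v : 'rV[R]_2) : cross u v != 0 ->
  cot (vec_angle u v) = dot u v / `|cross u v|.
Proof.
move=> uv; have [nu nv] := cross_enorm_gt0 uv.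
have [_ cE sE] := vec_angle_trig uv.
by rewrite /cot cE sE; field; rewrite normr_eq0 uv !gt_eqF.
Qed.

(** Cross-multiplying equal cotangents gives [sin (y - x) = 0], impossible when [0 < y - x < pi]. *)
Lemma cot_inj (R : realType) (x y : R) :
  0 < x < pi -> 0 < y < pi -> cot x = cot y -> x = y.
Proof.
wlog xy : x y / x <= y.
  move=> W hx hy e; case: (leP x y) => [|/ltW] h; first exact: W.
  by symmetry; apply: W.
move=> hx hy /eqP; rewrite /cot.
have [sx sy] := (sin_gt0_pi hx, sin_gt0_pi hy).
rewrite eqr_div ?(gt_eqF sx) ?(gt_eqF sy) // => /eqP e.
apply/eqP; rewrite eq_le xy leNgt; apply/negP => lt_xy.
have : 0 < sin (y - x) by apply: sin_gt0_pi; lra.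
by rewrite sinB [sin y * _]mulrC e subrr ltxx.
Qed.

(** * Collinearity as vanishing of the cross product *)

Lemma cross_eq0 (R : realType) (u v : 'rV[R]_2) : cross u v = 0 ->
  exists d : 'rV[R]_2, d != 0 /\ exists b c : R, u = b *: d /\ v = c *: d.
Proof.
rewrite /cross => /eqP; rewrite subr_eq0 => /eqP uv.
have [u0|u0] := eqVneq u 0; last first.
  (* The coefficient of [v] is that of its orthogonal projection onto [u]. *)
  exists u; split=> //; exists 1, (dot u v / dot u u); rewrite scale1r; split=> //.
  have : dot u u != 0.
    apply: contra_neq u0 => /eqP; rewrite dotE -!expr2.
    rewrite paddr_eq0 ?sqr_ge0 // !sqrf_eq0 => /andP[/eqP h0 /eqP h1].
    by apply: row2P; rewrite mxE.
  move=> d0.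
  apply: row2P; rewrite !mxE; apply: (mulIf d0); rewrite [RHS]mulrAC divfK //.
    by rewrite !dotE mulrDl mulrDr; ring: uv.
  by rewrite !dotE; ring: uv.
have [v0|v0] := eqVneq v 0.
  (* Both vectors vanish, so any nonzero direction serves. *)
  exists (const_mx 1); split; last by exists 0, 0; rewrite scale0r.
  by apply/eqP => /rowP/(_ 0)/eqP; rewrite !mxE oner_eq0.
by exists v; split=> //; exists 0, 1; rewrite scale0r scale1r.
Qed.

Lemma collinearP (R : realType) (T : triangle R) :
  collinear T <-> cross (qB T - qA T) (qC T - qA T) = 0.
Proof.
split=> [[p [d [_ [a [b [c [-> -> ->]]]]]]]|].
  by rewrite /cross !mxE; ring.
move=> /cross_eq0[d [d0 [b [c [eb ec]]]]].
exists (qA T), d; split=> //; exists 0, b, c.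
by rewrite -eb -ec scale0r addr0 !(addrC (qA T)) !subrK.
Qed.

(** * Invariance under similarities *)

Lemma dot_mulmx (R : realType) (M : 'M[R]_2) (u v : 'rV[R]_2) :
  M *m M^T = 1%:M -> dot (u *m M) (v *m M) = dot u v.
Proof.
have dotmx (x y : 'rV[R]_2) : dot x y = (x *m y^T) 0 0.
  by rewrite mxE; apply: eq_bigr => i _; rewrite mxE.
by move=> MM; rewrite !dotmx trmx_mul mulmxA -(mulmxA u) MM mulmx1.
Qed.

Lemma det2E (R : realType) (M : 'M[R]_2) :
  \det M = M 0 0 * M 1 1 - M 0 1 * M 1 0.
Proof.
rewrite (expand_det_row _ 0) sum2E /cofactor !det_mx11 !mxE /= expr0 expr1 mul1r.
have -> : lift (0 : 'I_2) 0 = 1 by apply/val_inj.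
have -> : lift (1 : 'I_2) 0 = 0 by apply/val_inj.
by rewrite mulN1r mulrN.
Qed.

Lemma cross_mulmx (R : realType) (M : 'M[R]_2) (u v : 'rV[R]_2) :
  cross (u *m M) (v *m M) = \det M * cross u v.
Proof. by rewrite /cross !mxE !sum2E det2E; ring. Qed.

Lemma similarity_subr (R : realType) (lam : R) (M : 'M[R]_2) (b u v : 'rV[R]_2) :
  lam *: (u *m M) + b - (lam *: (v *m M) + b) = lam *: ((u - v) *m M).
Proof. by rewrite opprD addrACA subrr addr0 -scalerBr -mulmxBl. Qed.

(** A point of the curve is a whole similarity class, and its coordinates may be read off any
    member; this carries the angle condition over to that member. *)
Lemma similar_angle_A (R : realType) (T1 T2 : triangle R) :
  Defs.similar T1 T2 -> interior_angle_A T2 = interior_angle_A T1.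
Proof.
move=> [lam [M [b [lam0 MM _ [eA eB eC]]]]]; rewrite /interior_angle_A eA eB eC.
rewrite !similarity_subr vec_angleZ //.
by rewrite /vec_angle /enorm !dot_mulmx.
Qed.

(** The cross product of the sides at A is multiplied by [lam ^+ 2 * \det M = lam ^+ 2], which is
    nonzero. *)
Lemma similar_collinear (R : realType) (T1 T2 : triangle R) :
  Defs.similar T1 T2 -> collinear T2 -> collinear T1.
Proof.
move=> [lam [M [b [lam0 _ detM [eA eB eC]]]]] /collinearP.
rewrite eA eB eC !similarity_subr crossZ cross_mulmx detM mul1r => /eqP.
by rewrite !mulf_eq0 (gt_eqF lam0) => /eqP/collinearP.
Qed.

Lemma similar_refl (R : realType) (T : triangle R) : Defs.similar T T.
Proof.
by exists 1, 1%:M, 0; split=> /=; rewrite ?trmx1 ?det1 ?mulmx1 ?scale1r ?addr0.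
Qed.

(** * Jacobi vectors and shape coordinates *)

Lemma cross_jacobi (R : realType) (T : triangle R) :
  cross (jacobi1 T) (jacobi2 T) = cross (qB T - qA T) (qC T - qA T).
Proof. by rewrite /jacobi1 /jacobi2 /cross !mxE; field. Qed.

(** Polarization: the sides at A are [- R2 - R1 / 2] and [- R2 + R1 / 2]. *)
Lemma dot_jacobi (R : realType) (T : triangle R) :
  dot (qB T - qA T) (qC T - qA T) =
  enorm (jacobi2 T) ^+ 2 - enorm (jacobi1 T) ^+ 2 / 4.
Proof. by rewrite !enorm_sqr !dotE /jacobi1 /jacobi2 !mxE; field. Qed.

Lemma jacobi_angleE (R : realType) (T : triangle R) :
  jacobi_angle T = vec_angle (jacobi1 T) (jacobi2 T).
Proof. by rewrite /jacobi_angle vec_angleZ // sqrtr_gt0 /mu1 /mu2; lra. Qed.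

Lemma jacobi_ratioE (R : realType) (T : triangle R) :
  jacobi_ratio T = 2 / Num.sqrt 3 * (enorm (jacobi2 T) / enorm (jacobi1 T)).
Proof.
rewrite /jacobi_ratio !enormZ ?sqrtr_ge0 // -mulf_div; congr (_ * _).
have h2 : 0 < Num.sqrt (2 : R) by rewrite sqrtr_gt0.
have h3 : 0 < Num.sqrt (3 : R) by rewrite sqrtr_gt0.
rewrite /mu1 /mu2 !sqrtrM // !sqrtrV // sqrtr1.
have := @sqr_sqrtr R 2 (ler0n _ _).
(* The numerator 2 on the right becomes the square of [Num.sqrt 2], so that [field] sees a rational
   identity in the two roots. *)
move=> e; rewrite -{3}e; field; by rewrite !gt_eqF.
Qed.

(** With [n], [m] the lengths of the median and the base, [D = n ^+ 2 - m ^+ 2 / 4] and [X] the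
    absolute cross product, both sides reduce to [D = k * X]. *)
Lemma coordinates_angleP (R : realType) (T : triangle R) (k Theta Phi : R) :
  k != 0 -> ~ collinear T -> has_coordinates T Theta Phi ->
  cot (interior_angle_A T) = k <->
  sin Phi = (1 - 2 * cos Theta) / (Num.sqrt 3 * k * sin Theta).
Proof.
move=> k0 /collinearP/eqP X0 [hT]; rewrite jacobi_ratioE jacobi_angleE => tE ->.
rewrite cot_vec_angle // dot_jacobi.
move: X0; rewrite -cross_jacobi => X0.
have [n1 n2] := cross_enorm_gt0 X0.
have [_ _ ->] := vec_angle_trig X0.
move: tE; set n := enorm _; set m := enorm (jacobi1 T); set X := `|_| => tE.
have X_gt0 : 0 < X by rewrite normr_gt0.
have c0 : 0 < cos (Theta / 2) by apply: cos_gt0_pihalf; lra.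
have s3 : 0 < Num.sqrt (3 : R) by rewrite sqrtr_gt0.
have sE : sin (Theta / 2) = 2 / Num.sqrt 3 * (n / m) * cos (Theta / 2).
  by rewrite tE /tan divfK ?gt_eqF.
have e3 : Num.sqrt (3 : R) ^+ 2 = 3 by rewrite sqr_sqrtr.
(* Half-angle form; 3 is kept as a square so that it cancels against the roots in [sE]. *)
have cE : 1 - 2 * cos Theta =
    Num.sqrt 3 ^+ 2 * sin (Theta / 2) ^+ 2 - cos (Theta / 2) ^+ 2.
  by rewrite e3 {1}(splitr Theta) cosD; have := cos2Dsin2 (Theta / 2); lra.
have sTE : sin Theta = 2 * sin (Theta / 2) * cos (Theta / 2).
  by rewrite {1}(splitr Theta) sinD; ring.
have -> : (1 - 2 * cos Theta) / (Num.sqrt 3 * k * sin Theta) =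
    (n ^+ 2 - m ^+ 2 / 4) / (k * (m * n)).
  (* Numerator and denominator are now both multiples of [cos (Theta / 2) ^+ 2], which cancels. *)
  rewrite cE sTE sE.
  by field; rewrite k0 !gt_eqF.
have kmn0 : k * (m * n) != 0 by rewrite !mulf_neq0 ?(gt_eqF n1) ?(gt_eqF n2).
set D := _ - _; split=> [e|e].
  have -> : D = k * X by rewrite -e divfK ?gt_eqF.
  by field; rewrite k0 !gt_eqF.
have -> : D = k * X by rewrite -[LHS](divfK kmn0) -e; field; rewrite !gt_eqF.
by rewrite mulfK ?gt_eqF.
Qed.

(** Supplies the inclusion of the graph in the curve, through an explicit triangle in normal
    position. *)
Lemma exists_triangle (R : realType) (Theta Phi : R) :
  0 < Theta < pi -> 0 < Phi < pi ->
  exists T : triangle R, ~ collinear T /\ has_coordinates T Theta Phi.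
Proof.
move=> hT hP.
have c0 : 0 < cos (Theta / 2) by apply: cos_gt0_pihalf; lra.
have s0 : 0 < sin (Theta / 2) by apply: sin_gt0_pihalf; lra.
have sP : 0 < sin Phi by apply: sin_gt0_pi.
have s3 : 0 < Num.sqrt (3 : R) by rewrite sqrtr_gt0.
(* Length of the median over a base of length 1, obtained by inverting [jacobi_ratioE]. *)
pose r := Num.sqrt 3 / 2 * tan (Theta / 2).
have r0 : 0 < r by rewrite mulr_gt0 ?divr_gt0.
pose e : 'rV[R]_2 := delta_mx 0 0.
pose f : 'rV[R]_2 := \row_i (if i == 0 then cos Phi else sin Phi).
(* The base is centred at the origin along the first axis, so the median is the position vector of
   A, at polar angle [Phi]. *)
pose T := Triangle (r *: f) (- (2^-1 *: e)) (2^-1 *: e).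
have j1 : jacobi1 T = e by apply: row2P; rewrite /jacobi1 !mxE /=; field.
have j2 : jacobi2 T = r *: f.
  by rewrite /jacobi2 /T /= addNr scaler0 subr0.
have ne : enorm e = 1 by rewrite /enorm dotE !mxE /= mulr1 mulr0 addr0 sqrtr1.
have nf : enorm f = 1 by rewrite /enorm dotE !mxE /= -!expr2 cos2Dsin2 sqrtr1.
exists T; split.
  move=> /collinearP/eqP; rewrite -cross_jacobi j1 j2 -[e]scale1r crossZ.
  by rewrite /cross !mxE /= mul1r mul0r subr0 mul1r mulf_eq0 !gt_eqF.
split=> //.
  rewrite jacobi_ratioE j1 j2 enormZ ?ltW // ne nf /r.
  by field; rewrite gt_eqF.
rewrite jacobi_angleE j1 j2 -[e]scale1r vec_angleZ // /vec_angle ne nf.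
rewrite dotE !mxE /= !mulr1 divr1 mul1r mul0r addr0 cosK // in_itv /=.
by have /andP[/ltW -> /ltW ->] := hP.
Qed.

(** * The constant-angle curve in coordinates *)

Theorem theorem2 (R : realType) (alpha : R)
    (halpha : 0 < alpha < pi) (halpha2 : alpha != pi / 2) :
  let k := cot alpha in
  in_coordinates (constant_angle_curve alpha) =
    [set p : R * R | 0 < p.1 < pi /\
       arcsin_rel ((1 - 2 * cos p.1) / (Num.sqrt 3 * k * sin p.1)) p.2]
  /\
  (forall (T : triangle R) (Theta Phi : R),
     ~ collinear T -> has_coordinates T Theta Phi ->
     (interior_angle_A T = alpha <->
      sin Phi = (1 - 2 * cos Theta) / (Num.sqrt 3 * k * sin Theta))).
Proof.
move=> k.
have k0 : k != 0.
  (* On [[0, pi]] the cosine is injective and vanishes at [pi / 2], the excluded value of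
     [alpha]. *)
  rewrite mulf_neq0 ?invr_neq0 ?(gt_eqF (sin_gt0_pi halpha)) //.
  apply: contra_neq halpha2 => c0; apply: cos_inj; rewrite ?cos_pihalf //.
    by rewrite in_itv /=; lra.
  by rewrite in_itv /=; have := pi_gt0 R; lra.
have angleP (T : triangle R) (Theta Phi : R) :
    ~ collinear T -> has_coordinates T Theta Phi ->
    (interior_angle_A T = alpha <->
     sin Phi = (1 - 2 * cos Theta) / (Num.sqrt 3 * k * sin Theta)).
  move=> nT coordT; rewrite -(coordinates_angleP k0 nT coordT).
  (* Non-collinearity puts the angle at A in the open interval on which [cot] is injective. *)
  split=> [-> //|]; apply: cot_inj => //.
  by have /collinearP/eqP/vec_angle_trig[] := nT.
split=> //; apply/seteqP; split=> -[th ph] /=.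
  move=> [s [T [[T0 [nT0 aT0] <-] simT coordT]]].
  (* [T0] carries the angle condition but [T] carries the coordinates, so the condition is moved
     along [simT]. *)
  have nT : ~ collinear T by move=> /(similar_collinear simT).
  have [hth _ /= phE] := coordT; split=> //; split.
    have /collinearP/eqP := nT; rewrite -cross_jacobi => /vec_angle_trig[].
    by rewrite phE jacobi_angleE.
  by apply/(angleP T) => //; rewrite (similar_angle_A simT).
move=> [hth [hph sE]].
have [T [nT coordT]] := exists_triangle hth hph.
exists (Defs.shape T), T; split=> //; last exact: similar_refl.
by exists T => //; split=> //; apply/(angleP T th ph).
Qed.
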